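(* Let $n\ge 1$, let $A\in\mathbb{R}_{\max}^{n\times n}$ and let $\lambda\in\mathbb{R}_{\max}$ be a tropical algebraic eigenvalue of $A$. Then there exists $x=(x_i)\in\mathbb{R}_{\max}^n$ with $x\neq(\varepsilon,\ldots,\varepsilon)^T$ such that $$x^{T}\otimes A\otimes x=\lambda\otimes x^T\otimes x .$$ Furthermore, if $y$ denotes the scaled form of $x$, then $$y^{T}\otimes A\otimes y=\lambda .$$
   Context: $\mathbb{R}_{\max}=\mathbb{R}\cup\{-\infty\}$ is the tropical (max-plus) semiring with $a\oplus b=\max\{a,b\}$, $a\otimes b=a+b$, and additive neutral element $\varepsilon=-\infty$ (absorbing for $\otimes$). Write $[n]=\{1,\dots,n\}$. Matrix and vector operations are defined as in classical linear algebra with $(\oplus,\otimes)$ in place of $(+,\times)$; in particular $x^T\otimes A\otimes x=\max_{i,j\in[n]}(x_i+a_{ij}+x_j)$ and $x^T\otimes x=2\max_i x_i$. Tropical algebraic eigenvalues: the tropical characteristic polynomial of $A=(a_{ij})\in\mathbb{R}_{\max}^{n\times n}$ is the formal polynomial $P_A(X)=\mathrm{per}(A\oplus X\otimes I)=\bigoplus_{k=0}^n c_{n-k}\otimes X^{\otimes k}$, where $I$ is the tropical identity matrix ($0$ on the diagonal, $\varepsilon$ elsewhere), $c_0=0$, and for $1\le m\le n$, $c_m=\max_{J\subseteq[n],|J|=m}\ \max_{\sigma\in \mathrm{Sym}(J)}\sum_{i\in J}a_{i\sigma(i)}$. The tropical roots of a formal polynomial $P$ are: the points of $\mathbb{R}$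 at which the maximum in the associated polynomial function $X\mapsto\max_k(c_{n-k}+kX)$ is attained by at least two distinct monomials, and additionally $\varepsilon$ if $P$ has no constant term (i.e. its constant coefficient is $\varepsilon$). The tropical algebraic eigenvalues of $A$ are the tropical roots of $P_A$. For $v\in\mathbb{R}_{\max}^n$, $v\neq(\varepsilon,\ldots,\varepsilon)^T$, put $v^*=\max_i v_i$; the scaled form of $v$ is the vector $(v_1-v^*,\ldots,v_n-v^* )^T$. *)

(* Defs.v *)
From HB Require Import structures.
From mathcomp Require Import all_boot all_order all_fingroup all_algebra reals.

Set Implicit Arguments.
Unset Strict Implicit.
Unset Printing Implicit Defensive.

Import Order.TTheory GRing.Theory Num.Theory.
Local Open Scope ring_scope.

(* The max-plus semiring.  It is declared below as a commutative semiring of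
   the library, so that 0, 1, +, * at type [Rmax R] denote -oo, the real
   number 0, max and the addition of reals, and so that library matrices and
   polynomials over [Rmax R] are the max-plus ones. *)
Inductive Rmax (R : realType) : Type := NegInf | Fin of R.
Arguments NegInf {R}.

Section RmaxSemiring.
Variable R : realType.
Implicit Types a b c : Rmax R.

Definition option_of_Rmax a : option R := if a is Fin r then Some r else None.
Definition Rmax_of_option (o : option R) : Rmax R :=
  if o is Some r then Fin r else NegInf.
Lemma option_of_RmaxK : cancel option_of_Rmax Rmax_of_option.
Proof. by case. Qed.
HB.instance Definition _ := Choice.copy (Rmax R) (can_type option_of_RmaxK).

Definition Rmax_add a b : Rmax R :=
  match a, b with
  | Fin r, Fin s => Fin (Num.max r s)
  | NegInf, _ => b
  | _, NegInf => a
  end.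

Definition Rmax_mul a b : Rmax R :=
  match a, b with
  | Fin r, Fin s => Fin (r + s)
  | _, _ => NegInf
  end.

Lemma Rmax_addA : associative Rmax_add.
Proof. by case=> [|r] [|s] [|t] //=; rewrite maxA. Qed.
Lemma Rmax_addC : commutative Rmax_add.
Proof. by case=> [|r] [|s] //=; rewrite maxC. Qed.
Lemma Rmax_add0 : left_id NegInf Rmax_add.
Proof. by case. Qed.
Lemma Rmax_mulA : associative Rmax_mul.
Proof. by case=> [|r] [|s] [|t] //=; rewrite addrA. Qed.
Lemma Rmax_mulC : commutative Rmax_mul.
Proof. by case=> [|r] [|s] //=; rewrite addrC. Qed.
Lemma Rmax_mul1 : left_id (Fin 0) Rmax_mul.
Proof. by case=> [|r] //=; rewrite add0r. Qed.
Lemma Rmax_mulDl : left_distributive Rmax_mul Rmax_add.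
Proof. by case=> [|r] [|s] [|t] //=; rewrite addr_maxl. Qed.
Lemma Rmax_mul0 : left_zero NegInf Rmax_mul.
Proof. by []. Qed.
Lemma Rmax_one_neq0 : Fin 0 != NegInf :> Rmax R.
Proof. by []. Qed.

HB.instance Definition _ :=
  GRing.isNmodule.Build (Rmax R) Rmax_addA Rmax_addC Rmax_add0.
HB.instance Definition _ :=
  GRing.Nmodule_isComNzSemiRing.Build (Rmax R)
    Rmax_mulA Rmax_mulC Rmax_mul1 Rmax_mulDl Rmax_mul0 Rmax_one_neq0.

(* Max-plus division, used only with a finite second argument. *)
Definition Rmax_div a b : Rmax R :=
  match a, b with
  | Fin r, Fin s => Fin (r - s)
  | _, _ => NegInf
  end.

End RmaxSemiring.

Definition permanent (S : comPzSemiRingType) n (M : 'M[S]_n) : S :=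
  \sum_(s : 'S_n) \prod_(i < n) M i (s i).

Section Eigenvalues.
Variable R : realType.

Definition trop_char_poly n (A : 'M[Rmax R]_n) : {poly Rmax R} :=
  permanent (map_mx polyC A + 'X%:M).

(* [p`_i * Fin t ^+ i] is the value at [t] of the monomial of degree [i], and
   the evaluation [p.[Fin t]] is the maximum of these values. *)
Definition trop_root (p : {poly Rmax R}) (l : Rmax R) : Prop :=
  match l with
  | Fin t => exists i j : nat,
      [/\ (i < size p)%N, (j < size p)%N, i != j,
          p`_i * Fin t ^+ i = p.[Fin t] & p`_j * Fin t ^+ j = p.[Fin t]]
  | NegInf => p`_0 = NegInf
  end.

Definition trop_alg_eigenvalue n (A : 'M[Rmax R]_n) (l : Rmax R) : Prop :=
  trop_root (trop_char_poly A) l.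

(* The sum is the max-plus one: [vmax v] is the largest entry of [v]. *)
Definition vmax n (v : 'cV[Rmax R]_n) : Rmax R := \sum_(i < n) v i 0.

Definition scaled_form n (v : 'cV[Rmax R]_n) : 'cV[Rmax R]_n :=
  \col_i Rmax_div (v i 0) (vmax v).

(* The coefficients are the optimal values of assignments on the principal
   submatrices of [A]; all sums and products are max-plus ones. *)
Lemma coef_trop_char_poly n (A : 'M[Rmax R]_n) (m : nat) : (m <= n)%N ->
  (trop_char_poly A)`_(n - m) =
  \sum_(J : {set 'I_n} | #|J| == m)
    \sum_(s : 'S_n | perm_on J s) \prod_(i in J) A i (s i).
Proof.
move=> le_mn; rewrite /trop_char_poly /permanent.
have E (s : 'S_n) : \prod_(i < n) (map_mx polyC A + 'X%:M) i (s i) =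
    \sum_(J : {set 'I_n} | perm_on J s)
      (\prod_(i in J) A i (s i))%:P * 'X^(n - #|J|).
  under eq_bigr do rewrite !mxE.
  rewrite bigA_distr /= [RHS]big_mkcond /=; apply: eq_bigr => J _.
  rewrite (bigID (mem J)) /= rmorph_prod /=; case: ifP => [/subsetP sJ | nJ].
    congr (_ * _); first by apply: eq_bigr => i ->.
    rewrite (eq_bigr (fun=> 'X)) => [|i /[dup] iNJ /negbTE ->]; last first.
      by rewrite (_ : s i = i) ?eqxx //; apply/eqP; apply: contraNT iNJ => /sJ.
    rewrite big_const iter_mulr_1; congr ('X^_).
    have := cardsC J; rewrite card_ord => defn.
    transitivity (#|J| + #|~: J| - #|J|)%N; last by rewrite defn.
    by rewrite addKn; apply: eq_card => i; rewrite !inE.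
  have /subsetPn [i si iNJ] := negbT nJ.
  rewrite [X in _ * X](bigD1 i) //= (negbTE iNJ).
  by rewrite eq_sym (negbTE (si : s i != i)) mulr0n mul0r mulr0.
under eq_bigr do rewrite E.
rewrite (exchange_big_dep predT) //= coef_sum [RHS]big_mkcond; apply: eq_bigr => J _ /=.
rewrite coef_sum; case: eqVneq => [<- | neq].
  by apply: eq_bigr => s _; rewrite coefCM coefXn eqxx mulr1.
rewrite big1 // => s _; rewrite coefCM coefXn.
have leJ : (#|J| <= n)%N by rewrite -[leqRHS]card_ord max_card.
by rewrite eqn_sub2lE // eq_sym (negbTE neq) mulr0.
Qed.

End Eigenvalues.

(* Main.v *)
Require Import Defs.
From HB Require Import structures.
From mathcomp Require Import all_boot all_order all_fingroup all_algebra reals.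
From mathcomp Require Import lra zify.

Set Implicit Arguments.
Unset Strict Implicit.

Import Order.TTheory GRing.Theory Num.Theory.
Local Open Scope ring_scope.

(** Over the scaled vectors, the form [x^T A x] takes every value between
  the least diagonal entry and the largest entry of [A]: put [0] at an index
  [i] and a common value [s <= 0] elsewhere, so that the form becomes
  [max (a_ii, s + b, 2 s + c)], and let [s] vary.  An algebraic eigenvalue lies
  in that range.  If it exceeded all entries of [A], the monomial of degree [n]
  would strictly dominate all others; if it were below all diagonal entries,
  extending a permutation of [J] by fixed points outside [J] would show that the
  constant term strictly dominates all others. *)

(** * The natural order of the max-plus semiring *)

Notation "a <=m b" := (a + b = b) (at level 70, no associativity).

Section RmaxOrder.
Variable R : realType.
Implicit Types (a b c : Rmax R) (r t : R).

Lemma Rmax_FinD r t : Fin r + Fin t = Fin (Num.max r t).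
Proof. by []. Qed.

Lemma Rmax_FinM r t : Fin r * Fin t = Fin (r + t).
Proof. by []. Qed.

Lemma Rmax_addxx a : a <=m a.
Proof. by case: a => [|r] //; rewrite /GRing.add /= maxxx. Qed.

Lemma Rmax_Fin_le r t : (Fin r <=m Fin t) <-> r <= t.
Proof.
by rewrite Rmax_FinD; split=> [[/max_idPr]|/max_idPr ->].
Qed.

Lemma Rmax_le_trans a b c : a <=m b -> b <=m c -> a <=m c.
Proof. by move=> ab <-; rewrite addrA ab. Qed.

Lemma Rmax_le_total a b : a <=m b \/ b <=m a.
Proof.
case: a b => [|r] [|t]; [by left|by left|by right|].
by rewrite !Rmax_Fin_le; apply/orP/le_total.
Qed.

Lemma Rmax_le_mulr a b c : a <=m b -> a * c <=m b * c.
Proof. by rewrite -mulrDl => ->. Qed.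

Lemma Rmax_le_mull a b c : a <=m b -> c * a <=m c * b.
Proof. by rewrite -mulrDr => ->. Qed.

(** By distributivity this is cancellation of the finite factor [c] in [(a + b) * c = b * c]. *)
Lemma Rmax_mulIr a b c : c != 0 -> a * c <=m b * c -> a <=m b.
Proof.
case: c => [//|r] _; rewrite -mulrDl; move: (a + b) => d.
by case: d b => [|s] [|t] //; rewrite !Rmax_FinM => -[] /addIr ->.
Qed.

Lemma Rmax_FinX t k : Fin t ^+ k = Fin (t *+ k).
Proof. by elim: k => [//|k IHk]; rewrite exprS IHk mulrS. Qed.

Lemma Rmax_Fin_leX t b k : (0 < k)%N -> Fin t ^+ k <=m b ^+ k -> Fin t <=m b.
Proof.
case: k b => [//|k] [|r] _; first by rewrite [NegInf ^+ _]exprS mul0r Rmax_FinX.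
by rewrite !Rmax_FinX !Rmax_Fin_le lerMn2r.
Qed.

Lemma Rmax_le_sum (I : finType) (P : pred I) (F : I -> Rmax R) i :
  P i -> F i <=m \sum_(j | P j) F j.
Proof. by move=> Pi; rewrite (bigD1 i) //= addrA Rmax_addxx. Qed.

Lemma Rmax_sum_le (I : finType) (P : pred I) (F : I -> Rmax R) b :
  (forall i, P i -> F i <=m b) -> \sum_(j | P j) F j <=m b.
Proof.
by move=> le; elim/big_ind: _ => [//|x y xb yb|]; rewrite ?add0r// -addrA yb.
Qed.

(** The order is total, so a binary max is one of its arguments; a value other than [0] rules out
    the empty sum. *)
Lemma Rmax_sum_attained (I : finType) (P : pred I) (F : I -> Rmax R) :
  \sum_(j | P j) F j != 0 -> exists2 i, P i & \sum_(j | P j) F j = F i.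
Proof.
apply: (big_ind (fun x => x != 0 -> exists2 i, P i & x = F i)) => [|x y|i Pi _].
- by rewrite eqxx.
- move=> Hx Hy; case: (Rmax_le_total x y) => [->//|].
  by rewrite addrC => ->.
- by exists i.
Qed.

Lemma Rmax_prod_leX (I : finType) (K : {set I}) (F : I -> Rmax R) b :
  (forall i, i \in K -> F i <=m b) -> \prod_(i in K) F i <=m b ^+ #|K|.
Proof.
move=> le; rewrite -prodr_const.
elim/big_ind2: _ => [|x1 x2 y1 y2 lex ley|//]; first exact: Rmax_addxx.
apply: Rmax_le_trans (Rmax_le_mulr _ lex) _; exact: Rmax_le_mull.
Qed.

Lemma Rmax_prod_le_exists (I : finType) (K : {set I}) (F : I -> Rmax R) t :
  K != set0 -> \prod_(i in K) F i <=m Fin t ^+ #|K| ->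
  exists2 i, i \in K & F i <=m Fin t.
Proof.
move=> /set0Pn [i0 i0K] leprod.
have [/existsP [i /andP[iK /eqP le]]|/existsPn gt] :=
  boolP [exists i, (i \in K) && (F i + Fin t == Fin t)]; first by exists i.
(* Otherwise every factor over [K] exceeds [Fin t], hence is finite: the default value never occurs
   on [K], and the real sum of the [f i] strictly exceeds [#|K|] times [t]. *)
pose f i := odflt 0 (option_of_Rmax (F i)).
have fP i : i \in K -> F i = Fin (f i) /\ t < f i.
  move=> iK; have := gt i; rewrite iK /= /f.
  case: (F i) => [|r] /=; first by rewrite [NegInf + _]add0r eqxx.
  move=> /eqP ne; split=> //; rewrite ltNge; apply/negP => le.
  by apply: ne; apply/Rmax_Fin_le.
have E : \prod_(i in K) F i = Fin (\sum_(i in K) f i).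
  rewrite (eq_bigr (fun i => Fin (f i))) => [|i /fP[]//].
  by symmetry; apply: (big_morph (@Fin R)).
move: leprod; rewrite E Rmax_FinX Rmax_Fin_le -sumr_const leNgt => /negP[].
apply: ltr_sum => [|i /fP[]//]; apply/hasP; exists i0 => //.
Qed.

(* At [s = min (t - b, (t - c) / 2)] the larger of [s + b] and [2 s + c]
   equals [t]. *)
Lemma Rmax_quadratic_ivt a b c l : a <=m l -> l <=m a + b + c ->
  exists2 s, s <=m 1 & a + s * b + s * s * c = l.
Proof.
case: l => [|t] al lS.
  (* The witness [0] is -oo: it removes every term but [a]. *)
  by exists 0; rewrite ?add0r // !mul0r !addr0 -al addr0.
have [->|ne] := eqVneq a (Fin t).
  by exists 0; rewrite ?add0r // !mul0r !addr0.
suff [s s0 E] : exists2 s : R, s <= 0 & Fin s * b + Fin s * Fin s * c = Fin t.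
  by exists (Fin s); [apply/Rmax_Fin_le | rewrite -addrA E].
(* As [a] lies strictly below [Fin t], the upper bound must come from [b + c]. *)
have {lS} : Fin t <=m b + c.
  move: lS; rewrite -addrA; case: (Rmax_le_total a (b + c)) => [->//|].
  rewrite addrC => ->; rewrite addrC al => ta.
  by case/eqP: ne.
case: b c => [|b] [|c] //.
- rewrite [NegInf + _]add0r Rmax_Fin_le => le; exists ((t - c) / 2); first lra.
  rewrite mulr0 add0r !Rmax_FinM; congr Fin; lra.
- rewrite [_ + NegInf]addr0 Rmax_Fin_le => le; exists (t - b); first lra.
  rewrite mulr0 addr0 Rmax_FinM; congr Fin; lra.
rewrite Rmax_FinD Rmax_Fin_le => le.
exists (Num.min (t - b) ((t - c) / 2)).
  by move: le; rewrite ge_min le_max => /orP[] le; apply/orP; [left|right]; lra.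
rewrite !Rmax_FinM Rmax_FinD; congr Fin.
by case: (lerP (t - b) ((t - c) / 2)) => ?; case: lerP => ?; lra.
Qed.

End RmaxOrder.

(** * Bounds on the algebraic eigenvalues *)

Section CharPoly.
Variables (R : realType) (n : nat) (A : 'M[Rmax R]_n).
Implicit Types (t : R).

Lemma size_trop_char_poly : (size (trop_char_poly A) <= n.+1)%N.
Proof.
apply: (leq_trans (size_sum _ _ _)); apply/bigmax_leqP => s _.
suff H (r : seq 'I_n) :
    (size (\prod_(i <- r) (map_mx polyC A + 'X%:M)%R i (s i))%R <= (size r).+1)%N.
  by have := H (index_enum 'I_n); rewrite [X in (_ <= X.+1)%N -> _](_ : _ = n) //
    -[RHS](card_ord n) cardT enumT.
elim: r => [|i r IHr]; first by rewrite big_nil size_poly1.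
rewrite big_cons; apply: (leq_trans (size_polyMleq _ _)).
suff : (size ((map_mx polyC A + 'X%:M)%R i (s i)) <= 2)%N by move: IHr => /=; lia.
rewrite !mxE; apply: (leq_trans (size_polyD _ _)); rewrite geq_max size_polyC.
apply/andP; split; first by case: (_ != 0).
by case: (_ == _); rewrite ?mulr1n ?mulr0n ?size_polyX ?size_poly0.
Qed.

Lemma trop_monomial_le (p : {poly Rmax R}) t i :
  p`_i * Fin t ^+ i <=m p.[Fin t].
Proof.
case: (ltnP i (size p)) => [lti|/(nth_default 0) ->].
  rewrite horner_coef.
  exact: (@Rmax_le_sum _ _ xpredT (fun i : 'I__ => p`_i * Fin t ^+ i) (Ordinal lti)).
by rewrite mul0r add0r.
Qed.

(** Only the empty set with the identity permutation contributes, by an empty product. *)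
Lemma trop_char_poly_lead : (trop_char_poly A)`_n = 1.
Proof.
rewrite -{2}(subn0 n) coef_trop_char_poly //.
rewrite (big_pred1 set0) => [|J]; last by rewrite cards_eq0.
rewrite (big_pred1 1%g) => [|s]; first by rewrite big_set0.
rewrite /=; apply/idP/eqP => [s1|->]; last exact: perm_on1.
by apply/permP => i; rewrite perm1 (out_perm s1) ?inE.
Qed.

Lemma trop_char_poly_ge (J : {set 'I_n}) (s : 'S_n) : perm_on J s ->
  \prod_(i in J) A i (s i) <=m (trop_char_poly A)`_(n - #|J|).
Proof.
move=> sJ; have leJ : (#|J| <= n)%N by rewrite -[leqRHS]card_ord max_card.
rewrite coef_trop_char_poly //.
apply: Rmax_le_trans (Rmax_le_sum _ (eqxx #|J| : (fun K => #|K| == #|J|) J)).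
exact: (Rmax_le_sum (fun s : 'S_n => \prod_(i in J) A i (s i)) sJ).
Qed.

Lemma trop_char_poly_ge_perm (s : 'S_n) :
  \prod_i A i (s i) <=m (trop_char_poly A)`_0.
Proof.
have sT : perm_on setT s by apply/subsetP => i; rewrite inE.
have := trop_char_poly_ge sT; rewrite cardsT card_ord subnn.
by rewrite (eq_bigl xpredT) // => i; rewrite inE.
Qed.

Lemma trop_char_poly_attained k : (k <= n)%N -> (trop_char_poly A)`_k != 0 ->
  exists J : {set 'I_n}, exists s : 'S_n,
    [/\ #|J| = (n - k)%N, perm_on J s &
       (trop_char_poly A)`_k = \prod_(i in J) A i (s i)].
Proof.
move=> lekn; rewrite -{1 3}(subKn lekn) coef_trop_char_poly ?leq_subr // => ne.
have [J /eqP cJ E] := Rmax_sum_attained ne; rewrite E in ne *.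
by have [s sJ ->] := Rmax_sum_attained ne; exists J, s.
Qed.

(** The monomial of degree [n] is finite at [Fin t], so the maximum is finite too. *)
Lemma trop_char_poly_dominant_neq0 t k :
  (trop_char_poly A)`_k * Fin t ^+ k = (trop_char_poly A).[Fin t] ->
  (trop_char_poly A)`_k != 0.
Proof.
move=> Ek; apply/eqP => p0; have := trop_monomial_le (trop_char_poly A) t n.
by rewrite trop_char_poly_lead mul1r Rmax_FinX -Ek p0 mul0r.
Qed.

Lemma entry_le (i j : 'I_n) : A i j <=m \sum_k \sum_l A k l.
Proof.
apply: Rmax_le_trans (Rmax_le_sum (fun k => \sum_l A k l) (isT : xpredT i)).
exact: (Rmax_le_sum (fun l => A i l) (isT : xpredT j)).
Qed.

Lemma trop_eigenvalue_le_entries l :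
  trop_alg_eigenvalue A l -> l <=m \sum_i \sum_j A i j.
Proof.
case: l => [_|t [i [j [lti ltj neij Ei Ej]]]]; first exact: add0r.
have sz := size_trop_char_poly.
(* Two distinct degrees at most [n] cannot both be [n]. *)
have [k ltkn Ek] : exists2 k, (k < n)%N &
    (trop_char_poly A)`_k * Fin t ^+ k = (trop_char_poly A).[Fin t].
  by case: (ltnP i n) => ?; [exists i|exists j => //; move/eqP: neij; lia].
have pn0 := trop_char_poly_dominant_neq0 Ek.
have [J [s [cJ sJ Ep]]] := trop_char_poly_attained (ltnW ltkn) pn0.
apply: (@Rmax_Fin_leX _ _ _ (n - k)); first by rewrite subn_gt0.
apply: Rmax_le_trans (_ : (trop_char_poly A)`_k <=m _); last first.
  by rewrite Ep -cJ; apply: Rmax_prod_leX => a _; apply: entry_le.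
(* Multiplied by [Fin t ^+ k], the claim compares the leading monomial with the dominant one. *)
apply: (@Rmax_mulIr _ _ _ (Fin t ^+ k)); first by rewrite Rmax_FinX.
rewrite Ek -exprD subnK 1?ltnW //.
by have := trop_monomial_le (trop_char_poly A) t n; rewrite trop_char_poly_lead mul1r.
Qed.

Lemma diag_le_trop_eigenvalue l :
  trop_alg_eigenvalue A l -> exists i, A i i <=m l.
Proof.
case: l => [p0|t [i [j [lti ltj neij Ei Ej]]]].
  (* For the eigenvalue -oo the constant coefficient is -oo, hence so is the product of the
     diagonal, and one of its factors. *)
  have := trop_char_poly_ge_perm 1; rewrite p0 addr0.
  under eq_bigr do rewrite perm1.
  move=> E; suff [i /eqP Ai] : exists i, A i i == NegInf by exists i; rewrite Ai.
  apply/existsP; apply: contra_eqT E; rewrite negb_exists => /forallP ne.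
  elim/big_ind: _ => [//|[|x] [|y]//|k _]; exact: ne.
have sz := size_trop_char_poly.
have [k /andP[k_gt0 lekn] Ek] : exists2 k, (0 < k <= n)%N &
    (trop_char_poly A)`_k * Fin t ^+ k = (trop_char_poly A).[Fin t].
  by case: (posnP i) => ?; [exists j => //; move/eqP: neij; lia|exists i => //; lia].
have pn0 := trop_char_poly_dominant_neq0 Ek.
have [J [s [cJ sJ Ep]]] := trop_char_poly_attained lekn pn0.
have cJC : #|~: J| = k by have := cardsC J; rewrite card_ord cJ; lia.
have JC0 : ~: J != set0 by rewrite -card_gt0 cJC.
suff : \prod_(i in ~: J) A i i <=m Fin t ^+ #|~: J|.
  by move=> /(Rmax_prod_le_exists JC0) [a _ le]; exists a.
(* After multiplication by the coefficient, which is the weight of [s] on [J], the left side is the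
   weight of [s] on all indices, since [s] fixes those outside [J]. It is bounded by the constant
   term, hence by the dominant monomial. *)
rewrite cJC; apply: (@Rmax_mulIr _ _ _ _ pn0).
rewrite [_ ^+ _ * _]mulrC Ek Ep.
have -> : \prod_(i in ~: J) A i i * \prod_(i in J) A i (s i) = \prod_i A i (s i).
  rewrite mulrC [RHS](bigID (mem J)) /=; congr (_ * _).
  apply: eq_big => [a|a]; rewrite inE // => aJ.
  by rewrite (out_perm sJ).
apply: Rmax_le_trans (trop_char_poly_ge_perm s) _.
by have := trop_monomial_le (trop_char_poly A) t 0; rewrite expr0 mulr1.
Qed.

End CharPoly.

(** * Construction of the vector *)

Lemma scaled_form_id (R : realType) n (v : 'cV[Rmax R]_n) :
  vmax v = 1 -> scaled_form v = v.
Proof.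
move=> v1; apply/matrixP => i j; rewrite mxE v1 (ord1 j).
by case: (v i 0) => [|r] //=; rewrite subr0.
Qed.

Theorem theorem4p1 (R : realType) (n : nat) (hn : (1 <= n)%N)
    (A : 'M[Rmax R]_n) (lambda : Rmax R) (hl : trop_alg_eigenvalue A lambda) :
  exists x : 'cV[Rmax R]_n,
    [/\ x != 0,
        x^T *m A *m x = lambda *: (x^T *m x) &
        (scaled_form x)^T *m A *m scaled_form x = lambda%:M].
Proof.
have [i0 Ai0] := diag_le_trop_eigenvalue hl.
have := trop_eigenvalue_le_entries hl.
(* The coefficients of the form in [s]: [b] collects the off-diagonal entries of row and column
   [i0], and [c] the entries avoiding both. *)
pose b := \sum_(j | j != i0) A i0 j + \sum_(j | j != i0) A j i0.
pose c := \sum_(j | j != i0) \sum_(k | k != i0) A j k.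
have -> : \sum_i \sum_j A i j = A i0 i0 + b + c.
  rewrite (bigD1 i0) //= (bigD1 i0) //= -!addrA; congr (_ + (_ + _)).
  by rewrite -big_split; apply: eq_bigr => j _; rewrite (bigD1 i0).
move=> /(Rmax_quadratic_ivt Ai0) [s s_le1 Es].
pose x : 'cV[Rmax R]_n := \col_j (if j == i0 then 1 else s).
have x0 : x i0 0 = 1 by rewrite mxE eqxx.
have xs j : j != i0 -> x j 0 = s by rewrite mxE => /negbTE ->.
have x_le1 j : x j 0 <=m 1.
  by have [->|/xs ->] := eqVneq j i0; rewrite ?x0 ?Rmax_addxx.
have max1 (F : 'I_n -> Rmax R) : F i0 = 1 -> (forall j, F j <=m 1) -> \sum_j F j = 1.
  move=> F1 le; rewrite -(Rmax_le_sum F (isT : xpredT i0)) F1 addrC.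
  exact: Rmax_sum_le.
(* The semiring's [1] is the real number 0, so [x] is its own scaled form and [Q] below serves both
   equations. *)
have xmax : vmax x = 1 by apply: max1.
have xx : x^T *m x = 1%:M.
  apply/matrixP => i j; rewrite !ord1 !mxE eqxx /=.
  apply: max1 => [|k]; rewrite mxE ?x0 ?mulr1 //.
  by apply: Rmax_le_trans (Rmax_le_mulr _ (x_le1 k)) _; rewrite mul1r.
have Q : x^T *m A *m x = lambda%:M.
  apply/matrixP => i j; rewrite !ord1 !mxE eqxx /= mulr1n -Es.
  have xAE k : (x^T *m A) 0 k = A i0 k + s * \sum_(j | j != i0) A j k.
    rewrite mxE (bigD1 i0) //= mxE x0 mul1r big_distrr; congr (_ + _).
    by apply: eq_bigr => l /xs E; rewrite mxE E.
  rewrite (bigD1 i0) //= x0 mulr1 xAE.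
  under eq_bigr => k /xs -> do rewrite xAE mulrC mulrDr mulrA.
  rewrite big_split /= -!big_distrr /= exchange_big /= -/c.
  by rewrite /b mulrDr [s * _ + s * _]addrC !addrA.
exists x; split; last by rewrite scaled_form_id.
  by apply/eqP => /matrixP /(_ i0 0); rewrite x0 mxE.
by rewrite Q xx scale_scalar_mx mulr1.
Qed.
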